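(* For any positive integer $n$, \[ p_1(n)\le \frac{n(n-m-1)}{2}+\frac{m(m+1)(m+2)}{12},\quad\text{where } m=\left\lfloor \frac{-1+\sqrt{8n+1}}{2}\right\rfloor, \] and equality holds if $\frac{-1+\sqrt{8n+1}}{2}$ is an integer.
   Context: All graphs are finite and simple. For positive integers $\ell$ and $n$, $p_\ell(n)$ denotes the maximum number of edges in an $n$-vertex graph that contains no two vertices of equal degree connected by a path of length $\ell$ (a path with $\ell$ edges on $\ell+1$ distinct vertices, the two vertices being its endpoints). In particular $p_1(n)$ is the maximum number of edges of an $n$-vertex graph with no two adjacent vertices of equal degree. *)

(* Defs.v *)
From HB Require Import structures.
From mathcomp Require Import all_boot all_order all_algebra.
From mathcomp Require Import reals.

Set Implicit Arguments.
Unset Strict Implicit.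
Unset Printing Implicit Defensive.

Section Graphs.
Variable T : finType.

(* A simple graph with vertex type T is given by its edge set, a set of
   2-element subsets of T; adj is then symmetric and irreflexive, because
   [set x; x] has only one element. *)
Implicit Type E : {set {set T}}.

Definition simple_graph E : bool := [forall e in E, #|e| == 2].

Definition adj E : rel T := fun x y => [set x; y] \in E.

Definition degree E (x : T) : nat := #|[set y | adj E x y]|.

(* The tuple lists the l vertices that follow x on the path. *)
Definition path_connected E (l : nat) (x y : T) : bool :=
  [exists s : l.-tuple T, [&& path (adj E) x s, uniq (x :: s) & last x s == y]].

Definition no_equal_degree_path E (l : nat) : bool :=
  [forall x, forall y,
     (x != y) && (degree E x == degree E y) ==> ~~ path_connected E l x y].

End Graphs.

(* Every n-vertex graph is isomorphic to one on 'I_n, so the maximum is taken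
   over those. For l > 0 it is over a nonempty family (the edgeless graph
   qualifies), so the default value 0 of \max plays no role. *)
Definition max_edges (l n : nat) : nat :=
  \max_(E : {set {set 'I_n}} | simple_graph E && no_equal_degree_path E l) #|E|.

(* Main.v *)
(** In a graph with no two adjacent vertices of equal degree, the vertices of
    degree [n - k] form an independent set, and each of them has [k]
    non-neighbours (itself included), so there are at most [k] of them.  Hence
    [2 e = \sum_v (n - k_v)] where each value [k] is taken at most [k] times;
    comparing every [k_v] with [m + 1] bounds this by
    [n (n - m - 1) + \sum_(k <= m) k (m + 1 - k)], for any natural [m].
    When [n = 1 + 2 + ... + m], the complete multipartite graph with parts of
    sizes [1, ..., m] attains the bound. *)
Require Import Defs.
From HB Require Import structures.
From mathcomp Require Import all_boot all_order all_algebra.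
From mathcomp Require Import reals.
From mathcomp Require Import zify lra.

Set Implicit Arguments.
Unset Strict Implicit.
Unset Printing Implicit Defensive.

Import Order.TTheory GRing.Theory Num.Theory.

Section SimpleGraphs.
Variables (T : finType) (E : {set {set T}}).

Lemma adj_neq x y : simple_graph E -> adj E x y -> x != y.
Proof. by move=> /forall_inP sE /sE; rewrite cards2; case: (x != y). Qed.

Lemma no_equal_degree_path1P :
  reflect (forall x y, x != y -> adj E x y -> degree E x != degree E y)
          (no_equal_degree_path E 1).
Proof.
apply: (iffP forallP) => [noE x y neq_xy xy | noE x].
  move/forallP: (noE x) => /(_ y); rewrite neq_xy /=; apply: contraL => ->.
  rewrite negbK; apply/existsP; exists [tuple y].
  by rewrite /= xy inE neq_xy eqxx.
apply/forallP => y; apply/implyP => /andP[neq_xy eq_deg].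
apply/existsPn => -[[|z []] //= sz].
apply/negP => /and3P[/andP[xz _] _ /eqP eq_zy].
by move: (noE x y neq_xy); rewrite -eq_zy xz eq_zy eq_deg => /(_ isT).
Qed.

Lemma degree_le x : degree E x <= #|T|.
Proof. exact: max_card. Qed.

(** Sending a neighbour [y] to the edge [[set x; y]] is a bijection onto the edges at [x]; this
    prepares the double counting in [handshake]. *)
Lemma degree_incident x :
  simple_graph E -> degree E x = #|[set e in E | x \in e]|.
Proof.
move=> sE; rewrite /degree.
have inj : {in [set y | adj E x y] &, injective (fun y => [set x; y])}.
  move=> y z; rewrite !inE => /(adj_neq sE) neq_xy _ /setP/(_ y).
  by rewrite !inE eqxx orbT [y == x]eq_sym (negPf neq_xy) => /esym/eqP.
rewrite -(card_in_imset inj); apply: eq_card => e; rewrite inE.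
apply/imsetP/andP => [[y] | [eE xe]].
  by rewrite inE => xy ->; split=> //; rewrite !inE eqxx.
have /cards2P[a [b [_ def_e]]] : #|e| == 2 by exact: (forall_inP sE).
move: xe eE; rewrite def_e !inE => /orP[] /eqP <- eE; first by exists b; rewrite ?inE.
by exists a; rewrite 1?setUC // inE /adj setUC.
Qed.

Lemma handshake : simple_graph E -> \sum_x degree E x = 2 * #|E|.
Proof.
move=> sE; rewrite mulnC -sum_nat_const.
transitivity (\sum_(e in E) \sum_(x : T | x \in e) 1).
  rewrite (exchange_big_dep predT) //=; apply: eq_bigr => x _.
  by rewrite degree_incident // -sum1_card; apply: eq_bigl => e; rewrite inE.
by apply: eq_bigr => e eE; rewrite sum1_card; apply/eqP/(forall_inP sE).
Qed.

Lemma card_codegree (i : nat) :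
  simple_graph E -> no_equal_degree_path E 1 ->
  #|[set v | #|T| - degree E v == i]| <= i.
Proof.
move=> sE /no_equal_degree_path1P noE.
have [-> | [v]] := set_0Vmem [set v | #|T| - degree E v == i].
  by rewrite cards0.
rewrite inE => /eqP def_i.
have card_nonadj : #|~: [set y | adj E v y]| = i.
  by rewrite -def_i -(cardsC [set y | adj E v y]) addKn.
(* Vertices of one class share their degree, so the whole class lies among the [i] non-neighbours of
   [v]. *)
rewrite -[leqRHS]card_nonadj; apply/subset_leq_card/subsetP => w; rewrite !inE => /eqP def_w.
apply/negP => vw; have /negP := noE v w (adj_neq sE vw) vw; apply.
by have := degree_le v; have := degree_le w; lia.
Qed.

End SimpleGraphs.

(** The sum is the binomial coefficient of [m + 2] over 3: it counts the triples in {0, ..., m + 1}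
    by their middle element [i]. *)
Lemma sum_mul_subn m :
  6 * \sum_(i < m.+1) i * (m.+1 - i) = m * m.+1 * m.+2.
Proof.
have sum_id k : 2 * \sum_(i < k.+1) i = k * k.+1.
  by elim: k => [|k IH]; [rewrite big_ord1 | rewrite big_ord_recr /= mulnDr IH; lia].
elim: m => [|m IH]; first by rewrite big_ord1.
rewrite big_ord_recr /=.
have -> : \sum_(i < m.+1) i * (m.+2 - i) =
          \sum_(i < m.+1) i * (m.+1 - i) + \sum_(i < m.+1) i.
  rewrite -big_split /=; apply: eq_bigr => i _.
  by rewrite (subSn (ltnW (ltn_ord i))) mulnS addnC.
by have := sum_id m; nia.
Qed.

(** The bound is multiplied by 12, with the negative term moved to the left, so that it can be
    stated in [nat]. *)
Lemma card_edges_le (T : finType) (E : {set {set T}}) m :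
  simple_graph E -> no_equal_degree_path E 1 ->
  12 * #|E| + 6 * #|T| * m.+1 <= 6 * #|T| ^ 2 + m * m.+1 * m.+2.
Proof.
move=> sE noE; pose k v := #|T| - degree E v.
have deg_codeg : 2 * #|E| + \sum_v k v = #|T| ^ 2.
  rewrite -(handshake sE) -big_split /= -mulnn -sum_nat_const.
  by apply: eq_bigr => v _; rewrite subnKC // degree_le.
(* Only the term [i = k v] survives, and both sides vanish when [k v > m]. Exchanging the sums then
   brings in the class sizes bounded by [card_codegree]. *)
have layers v : m.+1 - k v = \sum_(i < m.+1) (k v == i) * (m.+1 - i).
  have [lt_km | le_mk] := ltnP (k v) m.+1.
    rewrite (bigD1 (Ordinal lt_km)) //= eqxx mul1n big1 ?addn0 // => i.
    by rewrite -val_eqE eq_sym /= => /negPf->.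
  rewrite big1 ?(eqP le_mk) // => i _.
  by rewrite gtn_eqF // (leq_trans (ltn_ord i)).
have excess : \sum_v (m.+1 - k v) <= \sum_(i < m.+1) i * (m.+1 - i).
  under eq_bigr do rewrite layers.
  rewrite exchange_big /=; apply: leq_sum => i _.
  rewrite -big_distrl leq_mul2r /= -big_mkcond sum1_card -cardsE.
  by rewrite card_codegree ?orbT.
(* Subtraction is truncated, so a vertex with [k v > m.+1] makes this strict. *)
have compare : #|T| * m.+1 <= \sum_v k v + \sum_v (m.+1 - k v).
  by rewrite -sum_nat_const -big_split /=; apply: leq_sum => v _; rewrite -leq_subLR.
by have := sum_mul_subn m; lia.
Qed.

Section CompleteMultipartite.
Variables (T : finType) (I : eqType) (c : T -> I).

Definition multipartite : {set {set T}} :=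
  [set e : {set T} | [exists x, exists y, (c x != c y) && (e == [set x; y])]].

Lemma adj_multipartite x y : adj multipartite x y = (c x != c y).
Proof.
rewrite /adj inE; apply/existsP/idP => [[a /existsP[b /andP[neq_ab]]] | neq_xy].
  (* If [[set x; y] = [set a; b]], then [a] and [b] both lie in [[set x; y]], so equal colours of
     [x] and [y] would force [c a = c b]. *)
  apply: contraL => /eqP eq_xy; apply/eqP => /setP eq_e.
  have := eq_e x; have := eq_e y; have := eq_e a; have := eq_e b.
  rewrite !inE !eqxx ?orbT.
  by case/orP=> /eqP e1 /orP[] /eqP e2; move: neq_ab; rewrite e1 e2 ?eq_xy eqxx.
by exists x; apply/existsP; exists y; rewrite neq_xy eqxx.
Qed.

Lemma simple_multipartite : simple_graph multipartite.
Proof.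
apply/forall_inP => e; rewrite inE => /existsP[x /existsP[y /andP[neq_xy /eqP->]]].
by rewrite cards2; have [eq_xy | //] := eqVneq x y; rewrite eq_xy eqxx in neq_xy.
Qed.

Lemma degree_multipartite x :
  degree multipartite x = #|T| - #|[set y | c y == c x]|.
Proof.
rewrite -(cardsC [set y | c y == c x]) addKn /degree; apply: eq_card => y.
by rewrite !inE adj_multipartite eq_sym.
Qed.

End CompleteMultipartite.

(** The [n] vertices enumerate the disjoint union of 'I_1, ..., 'I_m, and the colour of a vertex is
    the index of its summand. *)
Lemma coloring_with_class_sizes m n :
  n = \sum_(k < m) k.+1 ->
  exists c : 'I_n -> 'I_m, forall k, #|[set v | c v == k]| = k.+1.
Proof.
move=> def_n; pose U := {k : 'I_m & 'I_k.+1}.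
have cardU : #|{: U}| = n.
  by rewrite card_tagged sumnE big_map big_enum def_n; apply: eq_bigr => k _; rewrite card_ord.
exists (fun v => tag (enum_val (cast_ord (esym cardU) v))) => k.
pose f (j : 'I_k.+1) := cast_ord cardU (enum_rank (Tagged (fun k : 'I_m => 'I_k.+1) j)).
have inj_f : injective f.
  by move=> i j /cast_ord_inj/enum_rank_inj/eqP; rewrite eq_Tagged => /eqP.
rewrite -[RHS]card_ord -[RHS]cardsT -[RHS](card_imset _ inj_f).
apply: eq_card => v; rewrite [LHS]inE.
apply/eqP/imsetP => [|[j _ ->]]; last by rewrite cast_ordK enum_rankK.
case def_u: (enum_val _) => [k' j] /= eq_k; move: j def_u; rewrite eq_k => j def_u.
by exists j; rewrite // /f /Tagged -def_u enum_valK cast_ordKV.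
Qed.

(** Parts of different sizes give different degrees, so no edge joins vertices of equal degree; the
    edges are then counted through the degree sum. *)
Lemma multipartite_extremal m n :
  n = \sum_(k < m) k.+1 ->
  exists E : {set {set 'I_n}}, [/\ simple_graph E, no_equal_degree_path E 1 &
    12 * #|E| + 6 * n * m.+1 = 6 * n ^ 2 + m * m.+1 * m.+2].
Proof.
move=> def_n; have [c card_c] := coloring_with_class_sizes def_n.
have le_cn v : (c v).+1 <= n.
  by rewrite -card_c -[X in _ <= X]card_ord max_card.
have deg v : degree (multipartite c) v = n - (c v).+1.
  by rewrite degree_multipartite card_ord card_c.
exists (multipartite c); split; first exact: simple_multipartite.
  apply/no_equal_degree_path1P => x y _; rewrite adj_multipartite !deg -val_eqE /=.
  by have := le_cn x; have := le_cn y; lia.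
(* Each of the [k.+1] vertices of part [k] contributes [k.+1]. *)
have codeg : \sum_v (c v).+1 = \sum_(k < m) k.+1 ^ 2.
  rewrite (partition_big c predT) //=; apply: eq_bigr => k _.
  rewrite -mulnn -{1}card_c -sum_nat_const.
  by apply: eq_big => [v | v /eqP->]; rewrite ?inE.
have deg_codeg : 2 * #|multipartite c| + \sum_v (c v).+1 = n ^ 2.
  rewrite -(handshake (simple_multipartite c)) -big_split /= -mulnn.
  under eq_bigr do rewrite deg subnK //.
  by rewrite sum_nat_const card_ord.
have sum_id : 2 * n = m * m.+1.
  rewrite def_n; elim: (m) => [|k IH]; first by rewrite big_ord0.
  by rewrite big_ord_recr /= mulnDr IH; lia.
have sum_sq : 6 * \sum_(k < m) k.+1 ^ 2 = m * m.+1 * (2 * m + 1).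
  elim: (m) => [|k IH]; first by rewrite big_ord0.
  by rewrite big_ord_recr /= mulnDr IH; lia.
have scaled : 6 * n * m.+1 = 3 * (m * m.+1) * m.+1 by rewrite -sum_id; lia.
by move: deg_codeg sum_sq; rewrite codeg; move: (\sum_(k < m) _) #|_| => S e; lia.
Qed.

Lemma max_edges1_le m n :
  12 * max_edges 1 n + 6 * n * m.+1 <= 6 * n ^ 2 + m * m.+1 * m.+2.
Proof.
rewrite /max_edges.
(* The edgeless graph makes the family nonempty, so some graph [E] attains the maximum. *)
have [|E /andP[sE noE] ->] := @eq_bigmax_cond _
  (fun E : {set {set 'I_n}} => simple_graph E && no_equal_degree_path E 1)
  (fun E => #|E|).
  apply/card_gt0P; exists set0; apply/andP; split.
    by apply/forall_inP => e; rewrite inE.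
  by apply/no_equal_degree_path1P => x y _; rewrite /adj inE.
by have := card_edges_le m sE noE; rewrite card_ord.
Qed.

Lemma max_edges1_triangular m n :
  2 * n = m * m.+1 ->
  12 * max_edges 1 n + 6 * n * m.+1 = 6 * n ^ 2 + m * m.+1 * m.+2.
Proof.
move=> tri_n; have def_n : n = \sum_(k < m) k.+1.
  suff: 2 * \sum_(k < m) k.+1 = m * m.+1 by lia.
  elim: (m) => [|k IH]; first by rewrite big_ord0.
  by rewrite big_ord_recr /= mulnDr IH; lia.
have [E [sE noE cardE]] := multipartite_extremal def_n.
apply/eqP; rewrite eqn_leq max_edges1_le -cardE leq_add2r leq_mul2l /=.
by apply: (bigop.bigmax_sup E) => //; rewrite sE.
Qed.

Local Open Scope ring_scope.

Theorem theorem4p2 (R : realType) (n : nat) (hn : (0 < n)%N) :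
  let x : R := (-1 + Num.sqrt (8 * n%:R + 1)) / 2 in
  let m : R := (Num.floor x)%:~R in
  let bound : R :=
    n%:R * (n%:R - m - 1) / 2 + m * (m + 1) * (m + 2) / 12 in
  (max_edges 1 n)%:R <= bound /\
  (x \is a Num.int -> (max_edges 1 n)%:R = bound).
Proof.
move=> x m bound.
have x_ge0 : 0 <= x.
  suff : 1 <= Num.sqrt (8 * n%:R + 1) :> R by rewrite /x; lra.
  by rewrite -{1}(@sqrtr1 R) ler_wsqrtr // lerDr mulr_ge0.
(* Since [x] is nonnegative, its floor is a natural number, to which the bounds in [nat] apply. *)
have [k def_k] : exists k : nat, Num.floor x = k%:Z.
  by have := floor_ge0 x; rewrite x_ge0; case: (Num.floor x) => // k _; exists k.
have def_m : m = k%:R by rewrite /m def_k.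
split=> [|x_int].
  have : (12 * max_edges 1 n + 6 * n * k.+1)%:R
           <= (6 * n ^ 2 + k * k.+1 * k.+2)%:R :> R by rewrite ler_nat max_edges1_le.
  rewrite !(natrD, natrM, natrX) -[k.+2%:R]natr1 -[k.+1%:R]natr1 /bound def_m; lra.
(* An integer [x] equals its floor [k], so the square root is [2 * k + 1]; squaring shows that [n]
   is the [k]-th triangular number. *)
have tri_n : (2 * n = k * k.+1)%N.
  have def_x : x = k%:R by rewrite -def_m /m; apply/esym/eqP; rewrite -intrEfloor.
  have sq : (Num.sqrt (8 * n%:R + 1)) ^+ 2 = 8 * n%:R + 1 :> R.
    by rewrite sqr_sqrtr // addr_ge0 ?mulr_ge0.
  have sqrt_k : Num.sqrt (8 * n%:R + 1) = 2 * k%:R + 1 :> R.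
    by move: def_x; rewrite /x; lra.
  apply/eqP; rewrite -(eqr_nat R) !natrM -natr1; apply/eqP.
  by move: sq; rewrite sqrt_k; lra.
have : (12 * max_edges 1 n + 6 * n * k.+1)%:R
         = (6 * n ^ 2 + k * k.+1 * k.+2)%:R :> R by rewrite max_edges1_triangular.
rewrite !(natrD, natrM, natrX) -[k.+2%:R]natr1 -[k.+1%:R]natr1 /bound def_m; lra.
Qed.
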